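(* Let $G$ be a finitely generated solvable group. Then $G$ is discriminating if and only if $G$ is isomorphic to $\mathbb{Z}^n$ for some integer $n \ge 0$.
   Context: A group $G$ is called discriminating if for every integer $N$ and every elements $h_1,\dots,h_N \in G\times G$ there exists a group homomorphism $\rho: G\times G \to G$ such that, for each $i$, $\rho(h_i)=1$ if and only if $h_i=1$. *)

(* Defs.v *)
From HB Require Import structures.
From mathcomp Require Import all_boot all_order all_algebra.
From Stdlib Require Import List.
Set Implicit Arguments. Unset Strict Implicit. Unset Printing Implicit Defensive.
Import GRing.Theory.

Record group := Group {
  carrier :> Type;
  gmul : carrier -> carrier -> carrier;
  ginv : carrier -> carrier;
  gone : carrier;
  gmulA : forall x y z, gmul x (gmul y z) = gmul (gmul x y) z;
  gmul1 : forall x, gmul gone x = x;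
  gmulV : forall x, gmul (ginv x) x = gone
}.

Arguments gmul {g}. Arguments ginv {g}. Arguments gone {g}.

Definition is_hom (A B : group) (f : A -> B) : Prop :=
  forall x y, f (gmul x y) = gmul (f x) (f y).

Definition isomorphic (A B : group) : Prop :=
  exists f : A -> B, is_hom f /\ bijective f.

Inductive gen (G : group) (S : G -> Prop) : G -> Prop :=
  | gen_one : gen S gone
  | gen_in : forall x, S x -> gen S x
  | gen_mul : forall x y, gen S x -> gen S y -> gen S (gmul x y)
  | gen_inv : forall x, gen S x -> gen S (ginv x).

Definition finitely_generated (G : group) : Prop :=
  exists s : list G, forall x : G, gen (fun y => In y s) x.

Definition gcomm (G : group) (x y : G) : G :=
  gmul (gmul (ginv x) (ginv y)) (gmul x y).

Fixpoint derived (G : group) (n : nat) : G -> Prop :=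
  match n with
  | 0 => fun _ => True
  | n'.+1 => gen (fun z => exists x y, @derived G n' x /\ @derived G n' y /\ z = gcomm x y)
  end.

Definition solvable_group (G : group) : Prop :=
  exists n, forall x : G, @derived G n x -> x = gone.

Section Prod.
Variable G : group.
Definition pmul (x y : G * G) : G * G := (gmul x.1 y.1, gmul x.2 y.2).
Definition pinv (x : G * G) : G * G := (ginv x.1, ginv x.2).
Lemma pmulA x y z : pmul x (pmul y z) = pmul (pmul x y) z.
Proof. by rewrite /pmul /= !gmulA. Qed.
Lemma pmul1 x : pmul (gone, gone) x = x.
Proof. by case: x => a b; rewrite /pmul /= !gmul1. Qed.
Lemma pmulV x : pmul (pinv x) x = (gone, gone).
Proof. by rewrite /pmul /= !gmulV. Qed.
Definition prod_group : group := Group pmulA pmul1 pmulV.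
End Prod.

Section Additive.
Local Open Scope ring_scope.
Variable V : zmodType.
Lemma addA' (x y z : V) : x + (y + z) = x + y + z. Proof. exact: addrA. Qed.
Lemma add0' (x : V) : 0 + x = x. Proof. exact: add0r. Qed.
Lemma addN' (x : V) : - x + x = 0. Proof. exact: addNr. Qed.
Definition additive_group : group := Group addA' add0' addN'.
End Additive.

Definition Zn (n : nat) : group := additive_group {ffun 'I_n -> int}.

Definition discriminating (G : group) : Prop :=
  forall hs : list (G * G),
    exists rho : prod_group G -> G,
      is_hom rho /\
      forall h, In h hs -> (rho h = gone <-> h = (gone, gone)).

(* Main.v *)
(* Compose discriminating maps to get a homomorphism from a large power of G to G, that
   is, pairwise commuting endomorphisms h_t that keep a given element w alive.
   Since G/G' is generated by g elements, over the localization of Z at a prime p at most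
   g of the induced subgroups of G/G' suffice to generate their sum.  Among 2g + 1 copies
   some h_t is therefore doubly redundant at p: for some m prime to p, the m-th powers of
   h_t(G) lie modulo G' in two subgroups generated by disjoint sets of other copies.
   Substituting such a configuration into another replaces m by a gcd, and choosing p to
   divide the current m drives it down to 1.  Then [f x, f y] lies in G'' for the final
   endomorphism f, so f maps each term of the derived series one step further (from G'
   on); as f does not kill w, taking w in the last nontrivial term shows that G' = 1.
   In the abelian case redundancy at p similarly excludes p-torsion. *)
Require Import Defs.
From mathcomp Require Import all_boot all_order all_algebra.
From mathcomp Require Import generic_quotient boolp zify ring.
From HB Require Import structures.
Set Implicit Arguments. Unset Strict Implicit. Unset Printing Implicit Defensive.
Import Order.TTheory GRing.Theory Num.Theory.

Local Open Scope ring_scope.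
Local Open Scope quotient_scope.

(** * Subgroups of abelian groups and generation up to an integer prime to [p] *)

Definition is_zsub (V : zmodType) (U : V -> Prop) : Prop :=
  U 0 /\ forall x y, U x -> U y -> U (x - y).

Lemma zsubN (V : zmodType) (U : V -> Prop) : is_zsub U -> forall x, U x -> U (- x).
Proof. by case=> U0 UB x Ux; rewrite -sub0r; apply: UB. Qed.

Lemma zsubD (V : zmodType) (U : V -> Prop) :
  is_zsub U -> forall x y, U x -> U y -> U (x + y).
Proof.
by move=> sU x y Ux Uy; rewrite -[y]opprK; apply: (proj2 sU) => //; apply: zsubN.
Qed.

Lemma zsubMn (V : zmodType) (U : V -> Prop) :
  is_zsub U -> forall x n, U x -> U (x *+ n).
Proof.
move=> sU x n Ux; elim: n => [|n IHn]; first by rewrite mulr0n; case: sU.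
by rewrite mulrS; apply: zsubD.
Qed.

Lemma zsubMz (V : zmodType) (U : V -> Prop) :
  is_zsub U -> forall x z, U x -> U (x *~ z).
Proof.
move=> sU x [n|n] Ux; first exact: zsubMn.
by rewrite NegzE mulrNz; apply: zsubN => //; apply: zsubMn.
Qed.

Lemma zsub_gcd (V : zmodType) (U : V -> Prop) (x : V) (m n : nat) :
  is_zsub U -> U (x *+ m) -> U (x *+ n) -> U (x *+ gcdn m n).
Proof.
move=> sU Um Un; have [->|m_gt0] := posnP m; first by rewrite gcd0n.
have [km kn Ekm _] := egcdnP n m_gt0.
suff ->: x *+ gcdn m n = x *+ m *+ km - x *+ n *+ kn.
  by apply: (proj2 sU); apply: zsubMn.
by rewrite -!mulrnA mulnC Ekm mulnC mulrnDr mulnC [X in X - _]addrC addrK.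
Qed.

(* Gaussian elimination over the localization of Z at p: the pivot is an entry of
   least p-adic valuation in the last coordinate. *)
Lemma local_generators (V : zmodType) (e : nat -> V) (k p : nat) (I : finType)
    (q : I -> V) :
  prime p ->
  (forall i, exists c : nat -> int, q i = \sum_(j < k) e j *~ c j) ->
  exists (B : {set I}) (m : nat), [/\ (#|B| <= k)%N, ~~ (p %| m)%N &
    forall U, is_zsub U -> (forall b, b \in B -> U (q b)) -> forall i, U (q i *+ m)].
Proof.
move=> p_pr; elim: k => [|k IHk] in q *.
  move=> qE; exists set0, 1%N; split; rewrite ?cards0 ?dvdn1 //; first by case: p p_pr => [|[]].
  by move=> U [U0 _] _ i; have [c ->] := qE i; rewrite big_ord0.
move=> /fin_all_exists[c qE].
have [/existsP[i0 nz0]|/existsPn z] := boolP [exists i, c i k != 0]; last first.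
  have [i|B [m [Bk pm BU]]] := IHk q; last by exists B, m; split => //; rewrite leqW.
  exists (c i); rewrite qE big_ord_recr /=.
  by have := z i; rewrite negbK => /eqP->; rewrite mulr0z addr0.
have [b nzb bmin] := @arg_minnP I i0 (fun i => c i k != 0) (fun i => logn p `|c i k|%N) nz0.
set l := logn p _ in bmin.
have div_l i : ((p ^ l)%:Z %| c i k)%Z.
  have [->|nzi] := eqVneq (c i k) 0; first exact: dvdz0.
  by rewrite dvdzE pfactor_dvdn ?absz_gt0 //; apply: bmin.
pose d i := (c i k %/ (p ^ l)%:Z)%Z.
have dE i : c i k = d i * (p ^ l)%:Z by rewrite divzK.
have pdb : ~~ (p %| `|d b|)%N.
  apply/negP => /dvdnP[t tE].
  have : (p ^ l.+1 %| `|c b k|)%N by rewrite dE abszM tE absz_nat -mulnA -expnS dvdn_mull.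
  by rewrite pfactor_dvdn ?absz_gt0 // ltnn.
(* Cross-multiplying with the pivot row clears the last coordinate; its only cost is the factor
   [d b], which is prime to [p]. *)
have [i|B [m [Bk pm BU]]] := IHk (fun i => q i *~ d b - q b *~ d i).
  exists (fun j => c i j * d b - c b j * d i).
  rewrite !qE !big_ord_recr /= !mulrzDl -!mulrzA.
  have ->: c i k * d b = c b k * d i by rewrite [c i k]dE [c b k]dE; ring.
  rewrite opprD addrACA subrr addr0 !mulrz_suml -sumrB.
  by apply: eq_bigr => j _; rewrite -!mulrzA -mulrzBr.
exists (b |: B), (`|d b|%N * m)%N; split.
- by rewrite cardsU1 -add1n leq_add ?leq_b1.
- by rewrite Euclid_dvdM // negb_or pdb.
move=> U sU Ub i; have Uqb := Ub b (setU11 _ _).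
have : U ((q i *~ d b - q b *~ d i) *+ m).
  apply: (BU U sU) => b' Bb'; apply: (proj2 sU); apply: zsubMz => //.
  by apply: Ub; rewrite setU1r.
rewrite mulrnBl => /(zsubD sU) /(_ (zsubMn sU m (zsubMz sU (d i) Uqb))); rewrite subrK.
rewrite mulrnA; case: (d b) => n /=; rewrite ?NegzE ?mulrNz ?mulNrn //.
by move=> /(zsubN sU); rewrite opprK.
Qed.

(** * Bases of finitely generated torsion-free abelian groups *)

Definition lincomb (V : zmodType) (n : nat) (e : 'I_n -> V) (c : 'I_n -> int) : V :=
  \sum_(i < n) e i *~ c i.

(** One step of Euclid's algorithm on the coefficients, compensated by an elementary change of
    generators. *)
Lemma lincomb_shear (V : zmodType) (n : nat) (e : 'I_n -> V) (i j : 'I_n) (s : int)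
    (c : 'I_n -> int) : i != j ->
  lincomb (fun l => if l == j then e j + e i *~ s else e l)
          (fun l => if l == i then c i - s * c j else c l) = lincomb e c.
Proof.
move=> nij; have nji : j != i by rewrite eq_sym.
rewrite /lincomb (bigD1 i) //= (bigD1 j) //= [RHS](bigD1 i) //=.
rewrite [X in _ = _ + X](bigD1 j) //= !eqxx (negPf nij) (negPf nji) !addrA.
congr (_ + _).
  by rewrite mulrzBr mulrzDl -mulrzA [X in _ + X]addrC addrA subrK.
by apply: eq_bigr => l /andP[/negPf-> /negPf->].
Qed.

Definition spans (V : zmodType) (n : nat) (e : 'I_n -> V) : Prop :=
  forall x, exists c, x = lincomb e c.

Definition torsion_free (V : zmodType) : Prop :=
  forall (x : V) (n : nat), (0 < n)%N -> x *+ n = 0 -> x = 0.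

Lemma torsion_freeMz (V : zmodType) : torsion_free V ->
  forall (x : V) (z : int), z != 0 -> x *~ z = 0 -> x = 0.
Proof.
move=> tf x [n|n] nz; first by apply: tf; rewrite lt0n.
by rewrite NegzE mulrNz => /eqP; rewrite oppr_eq0 => /eqP; apply: tf.
Qed.

(* Shears make the total size of the relation drop until one coefficient is left;
   the corresponding generator is then torsion, hence zero. *)
Lemma spans_shrink (V : zmodType) (n : nat) (e : 'I_n.+1 -> V) (c : 'I_n.+1 -> int) :
  torsion_free V -> spans e -> lincomb e c = 0 -> (exists i, c i != 0) ->
  exists e' : 'I_n -> V, spans e'.
Proof.
move=> tf; move: {2}(\sum_i `|c i|%N).+1 (ltnSn (\sum_i `|c i|%N)) => N.
elim: N e c => // N IHN e c ltN spe c0 [i0 nz0].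
have [/existsP[j0 /andP[nj0 nzj0]]|/existsPn one] :=
  boolP [exists j, (j != i0) && (c j != 0)]; last first.
  have e0 : e i0 = 0.
    apply: (torsion_freeMz tf nz0); move: c0; rewrite /lincomb (bigD1 i0) //= big1 ?addr0 //.
    by move=> j nj; have := one j; rewrite nj /= negbK => /eqP->; rewrite mulr0z.
  exists (fun l => e (lift i0 l)) => x; have [d ->] := spe x.
  exists (fun l => d (lift i0 l)); rewrite /lincomb (bigD1_ord i0) //=.
  by rewrite e0 mul0rz add0r.
have [i [j [nij nzj leji]]] : exists i j, [/\ i != j, c j != 0 & (`|c j| <= `|c i|)%N].
  have [le|lt] := leqP `|c j0|%N `|c i0|%N; first by exists i0, j0; rewrite eq_sym.
  by exists j0, i0; rewrite ltnW.
(* With [s] the sign relating [c i] and [c j], the new size is [|c i| - |c j|]. *)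
have [s sP] : exists s : int, (`|(c i - s * c j)%R| < `|c i|)%N.
  by exists (if (0 <= c i) == (0 <= c j) then 1 else -1); move: nzj leji; case: (lerP 0 (c i)) => ?; case: (lerP 0 (c j)) => ? /=; lia.
have inv d := lincomb_shear e s d nij.
apply: (IHN _ _ _ _ (etrans (inv c) c0)).
- rewrite ltnS in ltN; apply: leq_trans ltN.
  rewrite (bigD1 i) //= [X in (_ < X)%N](bigD1 i) //= eqxx -addSn leq_add //.
  by apply: leq_sum => l /negPf->.
- by move=> x; have [d ->] := spe x; eexists; rewrite -(inv d).
- by exists j; rewrite [j == i]eq_sym (negPf nij).
Qed.

(** As long as a nontrivial relation exists the spanning family can be shortened, so this stops at a
    free one. *)
Lemma torsion_free_basis (V : zmodType) (n : nat) (e : 'I_n -> V) :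
  torsion_free V -> spans e ->
  exists m (e' : 'I_m -> V), spans e' /\
    forall c, lincomb e' c = 0 -> forall i, c i = 0.
Proof.
move=> tf; elim: n e => [|n IHn] e spe; first by exists 0%N, e; split=> // c _ [].
have [[c [c0 nz]]|no] := EM (exists c, lincomb e c = 0 /\ exists i, c i != 0).
  by have [e' /IHn] := spans_shrink tf spe c0 nz.
exists n.+1, e; split=> // c c0 i; apply/eqP; apply/negPn/negP => nz.
by apply: no; exists c; split=> //; exists i.
Qed.

(** * Elementary group theory: homomorphisms, commutation, generated subgroups *)

Lemma gmulV' (G : group) (x : G) : gmul x (ginv x) = gone.
Proof.
rewrite -[LHS]gmul1 -{1}(gmulV (ginv x)) -gmulA [gmul (ginv x) (gmul _ _)]gmulA.
by rewrite gmulV gmul1 gmulV.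
Qed.

Lemma gmulx1 (G : group) (x : G) : gmul x gone = x.
Proof. by rewrite -(gmulV x) gmulA gmulV' gmul1. Qed.

Lemma gmulK (G : group) (x y : G) : gmul (gmul x y) (ginv y) = x.
Proof. by rewrite -gmulA gmulV' gmulx1. Qed.

Lemma gmulVK (G : group) (x y : G) : gmul (gmul x (ginv y)) y = x.
Proof. by rewrite -gmulA gmulV gmulx1. Qed.

Lemma gmulIr (G : group) (x y z : G) : gmul x z = gmul y z -> x = y.
Proof. by move=> E; rewrite -(gmulK x z) E gmulK. Qed.

Lemma ginvM (G : group) (x y : G) : ginv (gmul x y) = gmul (ginv y) (ginv x).
Proof. by apply: (@gmulIr _ _ _ (gmul x y)); rewrite gmulV gmulA gmulVK gmulV. Qed.

Lemma ginvK (G : group) (x : G) : ginv (ginv x) = x.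
Proof. by apply: (@gmulIr _ _ _ (ginv x)); rewrite gmulV gmulV'. Qed.

Lemma hom1 (A B : group) (f : A -> B) : is_hom f -> f gone = gone.
Proof. by move=> hf; apply: (@gmulIr _ _ _ (f gone)); rewrite -hf !gmul1. Qed.

Lemma homV (A B : group) (f : A -> B) : is_hom f -> forall x, f (ginv x) = ginv (f x).
Proof.
by move=> hf x; apply: (@gmulIr _ _ _ (f x)); rewrite -hf !gmulV hom1.
Qed.

Lemma hom_comm (A B : group) (f : A -> B) :
  is_hom f -> forall x y, f (gcomm x y) = gcomm (f x) (f y).
Proof. by move=> hf x y; rewrite /gcomm !hf !(homV hf). Qed.

Definition comm (G : group) (x y : G) : Prop := gmul x y = gmul y x.

Lemma comm_mul (G : group) (a x y : G) : comm a x -> comm a y -> comm a (gmul x y).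
Proof. by move=> cx cy; rewrite /comm gmulA cx -gmulA cy gmulA. Qed.

Lemma comm_inv (G : group) (a x : G) : comm a x -> comm a (ginv x).
Proof.
by move=> cx; apply: (@gmulIr _ _ _ x); rewrite gmulVK -gmulA cx gmulA gmulV gmul1.
Qed.

Lemma comm_gen (G : group) (a : G) (S : G -> Prop) :
  (forall x, S x -> comm a x) -> forall x, gen S x -> comm a x.
Proof.
move=> cS x; elim=> {x} [|x /cS //|x y _ cx _ cy|x _ cx].
- by rewrite /comm gmulx1 gmul1.
- exact: comm_mul.
- exact: comm_inv.
Qed.

Lemma comm_gen2 (G : group) (S T : G -> Prop) :
  (forall x y, S x -> T y -> comm x y) ->
  forall x y, gen S x -> gen T y -> comm x y.
Proof.
move=> cST x y gx gy; apply: comm_gen gy => t Tt; symmetry.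
by apply: (comm_gen _ gx) => s Ss; symmetry; apply: cST.
Qed.

Lemma gcomm_mull (G : group) (a x b : G) : comm a b -> gcomm (gmul a x) b = gcomm x b.
Proof.
move=> cab; rewrite /gcomm ginvM -!gmulA; congr gmul.
by rewrite [gmul (ginv b) _]gmulA -(comm_inv cab) -gmulA gmulA gmulV gmul1.
Qed.

Lemma gcomm_mulr (G : group) (b x z : G) : comm x b -> gcomm x (gmul b z) = gcomm x z.
Proof.
move=> cxb; rewrite /gcomm ginvM -!gmulA; congr gmul; congr gmul.
by rewrite [gmul x _]gmulA cxb -gmulA gmulA gmulV gmul1.
Qed.

Lemma gen_sub (G : group) (S T : G -> Prop) :
  (forall x, S x -> gen T x) -> forall x, gen S x -> gen T x.
Proof.
move=> sST x; elim=> {x} [|x /sST //|x y _ gx _ gy|x _ gx].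
- exact: gen_one.
- exact: gen_mul.
- exact: gen_inv.
Qed.

Lemma gen_hom (A B : group) (f : A -> B) (S : A -> Prop) (T : B -> Prop) :
  is_hom f -> (forall x, S x -> gen T (f x)) -> forall x, gen S x -> gen T (f x).
Proof.
move=> hf sST x; elim=> {x} [|x /sST //|x y _ gx _ gy|x _ gx].
- by rewrite hom1 //; apply: gen_one.
- by rewrite hf; apply: gen_mul.
- by rewrite homV //; apply: gen_inv.
Qed.

(** * The derived series and the abelianization as a Z-module *)

Lemma derived1_comm (G : group) (x y : G) : @derived G 1 (gcomm x y).
Proof. by apply: gen_in; exists x, y. Qed.

Lemma derived_hom (A B : group) (f : A -> B) n : is_hom f ->
  forall x, @derived A n x -> @derived B n (f x).
Proof.
move=> hf; elim: n => // n IHn; apply: gen_hom => // _ [x [y [dx [dy ->]]]].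
by rewrite hom_comm //; apply: gen_in; exists (f x), (f y); do !split; apply: IHn.
Qed.

(** Equality of left cosets of [G']; [{classic G}] lends the carrier the choice structure that the
    quotient requires. *)
Definition ab_rel (G : group) (x y : {classic G}) : bool :=
  `[< @derived G 1 (gmul (ginv (x : G)) (y : G)) >].

Lemma ab_refl (G : group) : reflexive (@ab_rel G).
Proof. by move=> x; apply/asboolP; rewrite gmulV; apply: gen_one. Qed.

Lemma ab_sym (G : group) : symmetric (@ab_rel G).
Proof.
suff S (x y : {classic G}) : ab_rel x y -> ab_rel y x by move=> x y; apply/idP/idP; apply: S.
by move=> /asboolP/gen_inv d; apply/asboolP; move: d; rewrite ginvM ginvK.
Qed.

Lemma ab_trans (G : group) : transitive (@ab_rel G).
Proof.
move=> y x z /asboolP dxy /asboolP dyz; apply/asboolP.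
by have := gen_mul dxy dyz; rewrite gmulA gmulK.
Qed.

Canonical ab_equiv (G : group) : equiv_rel {classic G} :=
  EquivRel (@ab_rel G) (@ab_refl G) (@ab_sym G) (@ab_trans G).

Definition abel (G : group) := {eq_quot (ab_equiv G)}.
HB.instance Definition _ (G : group) := Choice.on (abel G).

Definition pi_ab (G : group) (x : G) : abel G := \pi_({eq_quot (ab_equiv G)}) (x : {classic G}).
Definition repr_ab (G : group) (q : abel G) : G := repr (q : {eq_quot (ab_equiv G)}).

Lemma repr_abK (G : group) (q : abel G) : pi_ab (repr_ab q) = q.
Proof. exact: reprK. Qed.

Lemma pi_abP (G : group) (x y : G) :
  pi_ab x = pi_ab y <-> @derived G 1 (gmul (ginv x) y).
Proof. by split=> [/eqmodP/asboolP|d] //; apply/eqmodP/asboolP. Qed.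

(** Normality of [G'], from [y^-1 c y = c [c, y]]. *)
Lemma derived1_conj (G : group) (c y : G) :
  @derived G 1 c -> @derived G 1 (gmul (ginv y) (gmul c y)).
Proof.
move=> dc; have := gen_mul dc (derived1_comm c y).
by rewrite /gcomm !gmulA gmulV' gmul1 -!gmulA.
Qed.

Lemma eq_pi_abM (G : group) (x x' y y' : G) :
  pi_ab x = pi_ab x' -> pi_ab y = pi_ab y' -> pi_ab (gmul x y) = pi_ab (gmul x' y').
Proof.
move=> /pi_abP dx /pi_abP dy; apply/pi_abP.
by have := gen_mul (derived1_conj y dx) dy; rewrite ginvM -!gmulA [gmul y _]gmulA gmulV' gmul1.
Qed.

Definition add_ab (G : group) (p q : abel G) : abel G := pi_ab (gmul (repr_ab p) (repr_ab q)).
Definition opp_ab (G : group) (p : abel G) : abel G := pi_ab (ginv (repr_ab p)).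

Lemma add_abE (G : group) (x y : G) : add_ab (pi_ab x) (pi_ab y) = pi_ab (gmul x y).
Proof. by rewrite -[RHS](eq_pi_abM (repr_abK _) (repr_abK _)). Qed.

Lemma add_abA (G : group) : associative (@add_ab G).
Proof.
by move=> p q r; rewrite -[p]repr_abK -[q]repr_abK -[r]repr_abK !add_abE gmulA.
Qed.

Lemma add_abC (G : group) : commutative (@add_ab G).
Proof.
move=> p q; rewrite -[p]repr_abK -[q]repr_abK !add_abE; apply/pi_abP.
by rewrite ginvM; apply: derived1_comm.
Qed.

Lemma add_0ab (G : group) : left_id (pi_ab gone) (@add_ab G).
Proof. by move=> p; rewrite -[p]repr_abK add_abE gmul1. Qed.

Lemma add_Nab (G : group) : left_inverse (pi_ab gone) (@opp_ab G) (@add_ab G).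
Proof.
by move=> p; rewrite -{2}[p]repr_abK add_abE gmulV.
Qed.

HB.instance Definition _ (G : group) :=
  GRing.isZmodule.Build (abel G) (@add_abA G) (@add_abC G) (@add_0ab G) (@add_Nab G).

Lemma piM (G : group) (x y : G) : pi_ab (gmul x y) = pi_ab x + pi_ab y.
Proof. exact: esym (add_abE x y). Qed.

Lemma pi1 (G : group) : pi_ab (gone : G) = 0.
Proof. by []. Qed.

Lemma piV (G : group) (x : G) : pi_ab (ginv x) = - pi_ab x.
Proof. by apply/eqP; rewrite -addr_eq0 -piM gmulV. Qed.

Fixpoint gexp (G : group) (x : G) (n : nat) : G :=
  if n is n'.+1 then gmul x (gexp x n') else gone.

Lemma piX (G : group) (x : G) n : pi_ab (gexp x n) = pi_ab x *+ n.
Proof. by elim: n => [|n IHn]; rewrite ?mulr0n // mulrS /= piM IHn. Qed.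

Lemma hom_gexp (A B : group) (f : A -> B) : is_hom f ->
  forall x n, f (gexp x n) = gexp (f x) n.
Proof. by move=> hf x; elim=> [|n IHn] /=; rewrite ?hom1 // hf IHn. Qed.

(** Homomorphisms preserve [G'], hence act on abelianizations; working with representatives avoids
    building the induced map. *)
Lemma hom_pi (A B : group) (h : A -> B) (x y : A) (n : nat) :
  is_hom h -> pi_ab y = pi_ab x *+ n -> pi_ab (h y) = pi_ab (h x) *+ n.
Proof.
move=> hh; rewrite -!piX -hom_gexp // => /pi_abP d; apply/pi_abP.
by rewrite -homV // -hh; apply: derived_hom.
Qed.

Lemma pi_ab_inj (G : group) :
  (forall x : G, @derived G 1 x -> x = gone) -> injective (@pi_ab G).
Proof.
move=> ab x y /pi_abP /ab d; apply: (@gmulIr _ _ _ (ginv x)).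
by rewrite gmulV' -[gmul y _]gmul1 -(gmulV' x) -gmulA [gmul (ginv x) _]gmulA d gmul1 gmulV'.
Qed.

(** The first clause serves induction over words, the second provides integer coordinates. *)
Lemma ab_generated (G : group) : finitely_generated G ->
  exists (k : nat) (e : nat -> G),
    (forall x, gen (fun y => exists2 i, (i < k)%N & y = e i) x) /\
    forall q : abel G, exists c : nat -> int, q = \sum_(j < k) pi_ab (e j) *~ c j.
Proof.
case=> s gs; exists (size s), (nth gone s).
have g x : gen (fun y => exists2 i, (i < size s)%N & y = nth gone s i) x.
  apply: gen_sub (gs x) => {}x xs; apply: gen_in.
  elim: s xs {gs} => // a s IHs [<-|/IHs[i lti ->]]; first by exists 0%N.
  by exists i.+1.
split=> // q; rewrite -[q]repr_abK; elim: (g (repr_ab q)) => {q} [|_ [i lti ->]|x y _ [c cE] _ [d dE]|x _ [c cE]].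
- by exists (fun=> 0); rewrite big1.
- exists (fun j => (j == i)%:Z); rewrite (bigD1 (Ordinal lti)) //= eqxx mulr1z big1 ?addr0 //.
  by move=> j; rewrite -val_eqE /= => /negPf->; rewrite mulr0z.
- exists (fun j => c j + d j); rewrite piM cE dE -big_split.
  by apply: eq_bigr => j _; rewrite mulrzDr.
- exists (fun j => - c j); rewrite piV cE -sumrN.
  by apply: eq_bigr => j _; rewrite mulrNz.
Qed.

(** Only a generating set is carried along: [comm_gen] and [comm_gen2] extend commutation from it to
    the whole subgroup. *)
Definition in_image (G : group) (Y : G -> Prop) (q : abel G) : Prop :=
  exists2 y, gen Y y & pi_ab y = q.

Lemma in_image_zsub (G : group) (Y : G -> Prop) : is_zsub (in_image Y).
Proof.
split; first by exists gone => //; apply: gen_one.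
move=> _ _ [x gx <-] [y gy <-]; exists (gmul x (ginv y)); last by rewrite piM piV.
by apply: gen_mul => //; apply: gen_inv.
Qed.

Lemma in_image_sub (G : group) (Y Y' : G -> Prop) :
  (forall y, Y y -> Y' y) -> forall q, in_image Y q -> in_image Y' q.
Proof.
by move=> sY q [y gy <-]; exists y => //; apply: gen_sub gy => z /sY; apply: gen_in.
Qed.

Lemma in_image_hom (G : group) (h : G -> G) (Y : G -> Prop) (x : G) (m : nat) :
  is_hom h -> in_image Y (pi_ab x *+ m) ->
  in_image (fun z => exists2 y, Y y & z = h y) (pi_ab (h x) *+ m).
Proof.
move=> hh [y gy E]; exists (h y); last exact: hom_pi.
by apply: gen_hom gy => // z Yz; apply: gen_in; exists z.
Qed.

(** * Commuting copies obtained from discrimination, and their redundancy *)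

Fixpoint gprod (G : group) (F : nat -> G) (k : nat) : G :=
  if k is k'.+1 then gmul (gprod F k') (F k') else gone.

Lemma gprod1 (G : group) (F : nat -> G) k : (forall i, (i < k)%N -> F i = gone) -> gprod F k = gone.
Proof.
elim: k => //= k IHk F1; rewrite F1 // gmulx1 IHk // => i lti; apply: F1; exact: ltnW.
Qed.

Lemma pi_gprod (G : group) (F : nat -> G) k : pi_ab (gprod F k) = \sum_(i < k) pi_ab (F i).
Proof. by elim: k => [|k IHk]; rewrite ?big_ord0 // big_ord_recr /= piM IHk. Qed.

Lemma hom_gprod (A B : group) (f : A -> B) (F : nat -> A) k :
  is_hom f -> f (gprod F k) = gprod (fun i => f (F i)) k.
Proof. by move=> hf; elim: k => [|k IHk] /=; rewrite ?hom1 // hf IHk. Qed.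

Lemma eq_gprod (G : group) (F F' : nat -> G) k :
  (forall i, (i < k)%N -> F i = F' i) -> gprod F k = gprod F' k.
Proof.
elim: k => //= k IHk E; rewrite E // IHk // => i lti; apply: E; exact: ltnW.
Qed.

Lemma In_enum (J : finType) (x : J) : List.In x (enum J).
Proof.
by have := mem_enum J x; elim: (enum J) => //= a s IHs; rewrite inE => /orP[/eqP->|/IHs]; auto.
Qed.

(** Each step adds a copy: the old ones enter through the left factor of [G * G], the new one
    through the right, and the two factors commute. The pairs to discriminate are (product so far,
    new entry), one for each index in the finite type [J]. *)
Lemma discriminating_family (G : group) (k : nat) (J : finType) (z : J -> nat -> G) :
  discriminating G ->
  exists h : nat -> G -> G, [/\ forall i, is_hom (h i),
    forall i j x y, (i < k)%N -> (j < k)%N -> i != j -> comm (h i x) (h j y) &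
    forall c, gprod (fun i => h i (z c i)) k = gone ->
      forall i, (i < k)%N -> z c i = gone].
Proof.
move=> D; elim: k => [|k [h [hh hc hz]]]; first by exists (fun _ => id); split.
have [r [hr rz]] := D (map (fun c => (gprod (fun i => h i (z c i)) k, z c k)) (enum J)).
have hl : is_hom (fun x => r (x, gone)).
  by move=> x y; rewrite -hr /= /pmul /= gmul1.
have hri : is_hom (fun y => r (gone, y)).
  by move=> x y; rewrite -hr /= /pmul /= gmul1.
have rc x y : comm (r (x, gone)) (r (gone, y)).
  by rewrite /comm -!hr /= /pmul /= !gmul1 !gmulx1.
exists (fun i x => if (i < k)%N then r (h i x, gone) else r (gone, x)); split.
- by move=> i x y; case: ifP => _; rewrite ?hh ?hl ?hri.
- move=> i j x y; rewrite !ltnS => ik jk nij.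
  case: (ltnP i k) => [lti|gei]; case: (ltnP j k) => [ltj|gej]; last first.
  + by case/eqP: nij; apply/eqP; rewrite eqn_leq (leq_trans ik gej) (leq_trans jk gei).
  + by rewrite /comm rc.
  + exact: rc.
  + by rewrite /comm -!hl hc.
- move=> c /=; rewrite ltnn.
  rewrite (@eq_gprod _ _ (fun i => r (h i (z c i), gone))); last by move=> i ->.
  rewrite -(@hom_gprod _ _ (fun x => r (x, gone))) // -hr /= /pmul /= gmulx1 gmul1.
  have /rz -> : List.In (gprod (fun i => h i (z c i)) k, z c k)
      (map (fun c => (gprod (fun i => h i (z c i)) k, z c k)) (enum J)).
    by apply: (List.in_map (fun c => (gprod (fun i => h i (z c i)) k, z c k))); apply: In_enum.
  by case=> /hz zk E i; rewrite ltnS leq_eqVlt => /orP[/eqP->|/zk].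
Qed.

(* [w] survives in a copy of [G] all of whose [m]-th powers agree modulo [G'] with
   elements of two further subgroups, the three subgroups commuting pairwise. *)
Definition redundant (G : group) (w : G) (m : nat) : Prop :=
  exists (f : G -> G) (Y1 Y2 : G -> Prop),
    [/\ is_hom f, f w <> gone,
        forall x, in_image Y1 (pi_ab (f x) *+ m) /\ in_image Y2 (pi_ab (f x) *+ m) &
        [/\ forall x z, Y1 z -> comm (f x) z, forall x z, Y2 z -> comm (f x) z &
            forall z z', Y1 z -> Y2 z' -> comm z z']].

Lemma local_redundancy (G : group) (p : nat) (u : G) :
  discriminating G -> finitely_generated G -> prime p -> u <> gone ->
  exists2 m, ~~ (p %| m)%N & redundant u m.
Proof.
move=> D /ab_generated[g [e [eG eQ]]] p_pr u1; set k := (g + g).+1.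
(* The test tuples have [u] in one place and [gone] elsewhere, so that no copy kills [u]. *)
have [h [hh hc hz]] := discriminating_family k (fun (c : 'I_k) i => if i == c then u else gone) D.
have hu (t : 'I_k) : h t u <> gone.
  move=> E; apply: u1; have := hz t _ t (ltn_ord t); rewrite eqxx; apply.
  by apply: gprod1 => i _; case: eqP => [->|_] //; apply: hom1 (hh i).
have hcI (s t : 'I_k) x y : s != t -> comm (h s x) (h t y) by move=> nst; apply: hc; rewrite ?ltn_ord.
pose q (b : 'I_k * 'I_g) := pi_ab (h b.1 (e b.2)).
have [B1 [m1 [cB1 pm1 B1P]]] := local_generators (e := fun j => pi_ab (e j)) (q := q) p_pr (fun b => eQ (q b)).
pose J1 := [set b.1 | b in B1].
(* Zeroing the copies in [J1] makes the second local generating set draw only on other copies. *)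
pose q' b := if b.1 \in J1 then 0 else q b.
have [B2 [m2 [cB2 pm2 B2P]]] := local_generators (e := fun j => pi_ab (e j)) (q := q') p_pr (fun b => eQ (q' b)).
pose J2 := [set b.1 | b in B2] :\: J1.
(* [J1] and [J2] have at most [g] elements each, and there are [2g + 1] copies. *)
have [t tJ] : exists t, t \notin J1 :|: J2.
  apply/existsP; rewrite -negb_forall; apply/negP => /forallP all.
  have : (#|'I_k| <= #|J1 :|: J2|)%N by apply: subset_leq_card; apply/subsetP => t _.
  apply/negP; rewrite -ltnNge card_ord ltnS cardsU (leq_trans (leq_subr _ _)) //.
  rewrite leq_add // ?(leq_trans (leq_imset_card _ _)) //.
  by rewrite (leq_trans (subset_leq_card (subsetDl _ _))) // (leq_trans (leq_imset_card _ _)).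
have [tJ1 tJ2] : t \notin J1 /\ t \notin J2 by apply/andP; rewrite -negb_or -in_setU.
pose Z (J : {set 'I_k}) (z : G) := exists2 s, s \in J & exists x, z = h s x.
have inZ (J : {set 'I_k}) s x : s \in J -> in_image (Z J) (pi_ab (h s x)).
  by move=> sJ; exists (h s x) => //; apply: gen_in; exists s => //; exists x.
have Zgen J m : (forall j : 'I_g, in_image (Z J) (pi_ab (h t (e j)) *+ m)) ->
    forall x, in_image (Z J) (pi_ab (h t x) *+ m).
  move=> Ze x; have sZ := in_image_zsub (Z J).
  elim: (eG x) => {x} [|_ [j ltj ->]|x y _ Zx _ Zy|x _ Zx].
  - by rewrite (hom1 (hh t)) pi1 mul0rn; case: sZ.
  - exact: Ze (Ordinal ltj).
  - by rewrite hh piM mulrnDl; apply: zsubD.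
  - by rewrite (homV (hh t)) piV mulNrn; apply: zsubN.
have Zt (J : {set _}) x z : t \notin J -> Z J z -> comm (h t x) z.
  by move=> tnJ [s sJ [y ->]]; apply: hcI; apply: contraNneq tnJ => ->.
exists (m1 * m2)%N; first by rewrite Euclid_dvdM // negb_or pm1.
exists (h t), (Z J1), (Z J2); split => //.
- move=> x; split.
    rewrite mulrnA; apply: zsubMn; first exact: in_image_zsub.
    apply: Zgen x => j; apply: (B1P _ (in_image_zsub (Z J1)) _ (t, j)) => b bB.
    by apply: inZ; apply: imset_f.
  rewrite mulnC mulrnA; apply: zsubMn; first exact: in_image_zsub.
  apply: Zgen x => j; have := B2P _ (in_image_zsub (Z J2)) _ (t, j).
  rewrite /q' /= (negPf tJ1); apply=> b bB.
  case: ifPn => bJ; first by case: (in_image_zsub (Z J2)).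
  by apply: inZ; rewrite inE bJ imset_f.
- split=> [x z|x z|_ _ [s sJ [x ->]] [s' + [y ->]]]; try exact: Zt.
  by rewrite inE => /andP[s'J _]; apply: hcI; apply: contraNneq s'J => <-.
Qed.

(** Zeroth powers are trivial; this starts the descent, as [gcdn 0 n = n]. *)
Lemma redundant0 (G : group) (w : G) : w <> gone -> redundant w 0.
Proof.
move=> w1; exists id, (fun _ => False), (fun _ => False).
by split=> // x; split; rewrite mulr0n; case: (@in_image_zsub G (fun=> False)).
Qed.

(** Local redundancy is applied to [f w], so that [h \o f] keeps [w] alive. The new sets [Z1], [Z2]
    commute with the whole image of [h], in particular with the transported [Y1], [Y2]. *)
Lemma redundant_step (G : group) (w : G) (m p : nat) :
  discriminating G -> finitely_generated G -> prime p -> redundant w m ->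
  exists2 n, ~~ (p %| n)%N & redundant w (gcdn m n).
Proof.
move=> D fg p_pr [f [Y1 [Y2 [hf fw fY [cY1 cY2 cY]]]]].
have [n pn [h [Z1 [Z2 [hh hfw hZ [cZ1 cZ2 cZ]]]]]] := local_redundancy D fg p_pr fw.
exists n => //; pose U (Y Z : G -> Prop) z := (exists2 y, Y y & z = h y) \/ Z z.
have step Y Z x : in_image Y (pi_ab (f x) *+ m) -> in_image Z (pi_ab (h (f x)) *+ n) ->
    in_image (U Y Z) (pi_ab (h (f x)) *+ gcdn m n).
  move=> /(in_image_hom hh) iY iZ; apply: zsub_gcd; first exact: in_image_zsub.
    by apply: in_image_sub iY => z; left.
  by apply: in_image_sub iZ => z; right.
have ch x y : comm x y -> comm (h x) (h y) by rewrite /comm -!hh => ->.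
exists (fun x => h (f x)), (U Y1 Z1), (U Y2 Z2); split=> //.
- by move=> x y; rewrite hf hh.
- by move=> x; split; apply: step; [case: (fY x)|case: (hZ (f x))|case: (fY x)|case: (hZ (f x))].
- split=> [x z [[y Yy ->]|Zz]|x z [[y Yy ->]|Zz]|z z' [[y Yy ->]|Zz] [[y' Yy' ->]|Zz']]; auto.
  by apply/esym/cZ1.
Qed.

Lemma redundant1 (G : group) (w : G) :
  discriminating G -> finitely_generated G -> w <> gone -> redundant w 1.
Proof.
move=> D fg w1.
(* The prime 2 only serves to reach a positive exponent. *)
have [n n2 rn] := redundant_step D fg (isT : prime 2) (redundant0 w1).
rewrite gcd0n in rn; have {n2} n_gt0 : (0 < n)%N by case: n n2 {rn}.
elim/ltn_ind: n n_gt0 rn => n IHn n_gt0 rn.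
have [n_le1|n_gt1] := leqP n 1; first by have <- : n = 1%N by apply/eqP; rewrite eqn_leq n_le1.
(* The chosen prime divides [n] but not [m], so the gcd is a proper divisor of [n]. *)
have [m pm rm] := redundant_step D fg (pdiv_prime n_gt1) rn.
apply: IHn rm; last by rewrite gcdn_gt0 n_gt0.
rewrite ltn_neqAle dvdn_leq ?dvdn_gcdl // andbT.
by apply: contraNneq pm => /gcdn_idPl; apply: dvdn_trans; apply: pdiv_dvd.
Qed.

(* Write [f x = a c] and [f y = b d] with [a], [b] from the two commuting subgroups and
   [c], [d] in [G']: then [f x] and [f y] have the same commutator as [c] and [d]. *)
Lemma derived2_redundant (G : group) (f : G -> G) (Y1 Y2 : G -> Prop) :
  (forall x, in_image Y1 (pi_ab (f x)) /\ in_image Y2 (pi_ab (f x))) ->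
  (forall x z, Y1 z -> comm (f x) z) -> (forall x z, Y2 z -> comm (f x) z) ->
  (forall z z', Y1 z -> Y2 z' -> comm z z') ->
  forall x y, @derived G 2 (gcomm (f x) (f y)).
Proof.
move=> fY cY1 cY2 cY x y.
have [[a ga aE] [b gb bE]] : in_image Y1 (pi_ab (f x)) /\ in_image Y2 (pi_ab (f y)).
  by case: (fY x); case: (fY y).
have cxb : comm (f x) b by apply: comm_gen gb; apply: cY2.
have cya : comm (f y) a by apply: comm_gen ga; apply: cY1.
have cab : comm a b := comm_gen2 cY ga gb.
have <- : gcomm (gmul (ginv a) (f x)) (gmul (ginv b) (f y)) = gcomm (f x) (f y).
  (* [a] commutes with both [b] and [f y], so [ginv a] can be stripped first; then [ginv b] goes, as
     [b] commutes with [f x]. *)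
  rewrite gcomm_mull; last first.
    apply: comm_mul; last exact/esym/comm_inv.
    by apply: comm_inv; apply/esym/comm_inv/esym.
  by rewrite gcomm_mulr //; apply: comm_inv.
apply: gen_in; exists (gmul (ginv a) (f x)), (gmul (ginv b) (f y)).
by split; [apply/pi_abP|split; [apply/pi_abP|]].
Qed.

(** * Discriminating groups: commutativity and absence of torsion *)

Lemma discriminating_solvable_abelian (G : group) :
  discriminating G -> finitely_generated G -> solvable_group G ->
  forall x : G, @derived G 1 x -> x = gone.
Proof.
move=> D fg [n]; elim: n => [|n IHn] dn x; first by move=> _; apply: dn.
case: n IHn dn => [|n] IHn dn dx; first exact: dn.
(* It suffices to show that the term of index [n.+1] is trivial, given that the next one is. *)
apply: (IHn _ x dx) => w dw; apply: contrapT => w1.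
have [f [Y1 [Y2 [hf fw fY [cY1 cY2 cY]]]]] := redundant1 D fg w1.
apply: fw; apply: dn.
have d2 : forall x y, @derived G 2 (gcomm (f x) (f y)) := derived2_redundant fY cY1 cY2 cY.
(* [f] shifts the derived series by one: [d2] settles [G'], and commutators propagate the shift. *)
elim: n w dw {IHn w1} => [|n IHn]; apply: gen_hom => // _ [a [b [da [db ->]]]].
  by rewrite hom_comm //; apply: d2.
by rewrite hom_comm //; apply: gen_in; exists (f a), (f b); do !split; apply: IHn.
Qed.

(* If [p u = 0], a relation among [g + 1] discriminated copies of [u] has coefficients
   that matter only mod [p], and local redundancy at [p] provides a nontrivial one. *)
Lemma discriminating_torsion_free (G : group) :
  discriminating G -> finitely_generated G ->
  (forall x : G, @derived G 1 x -> x = gone) -> torsion_free (abel G).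
Proof.
move=> D /ab_generated[g [e [_ eQ]]] /pi_ab_inj pi_inj.
suff prime_case p (q : abel G) : prime p -> q *+ p = 0 -> q = 0.
  move=> q n; elim/ltn_ind: n q => n IHn q n_gt0 qn0.
  have [n_le1|n_gt1] := leqP n 1.
    by rewrite -qn0 (_ : n = 1%N) //; apply/eqP; rewrite eqn_leq n_le1.
  apply: (IHn (n %/ pdiv n)%N); rewrite ?ltn_Pdiv ?prime_gt1 ?pdiv_prime //.
    by rewrite divn_gt0 ?pdiv_gt0 // dvdn_leq ?pdiv_dvd.
  apply: prime_case (pdiv_prime n_gt1) _.
  by rewrite -mulrnA divnK ?pdiv_dvd.
move=> p_pr qp0; set k := g.+1; pose u := repr_ab q.
have p_gt0 := prime_gt0 p_pr.
(* The test family consists of the exponent vectors of [u] modulo [p], hence is finite; the default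
   0 concerns only indices from [k] on. *)
have [h [hh _ hz]] := discriminating_family k
  (fun (c : {ffun 'I_k -> 'I_p}) i => gexp u (if insub i is Some j then c j else 0%N)) D.
pose v (i : 'I_k) := pi_ab (h i u).
have vp i : v i *+ p = 0.
  rewrite -(@hom_pi _ _ (h i) u gone p) ?(hom1 (hh i)) //.
  by rewrite repr_abK qp0.
have modv i n : v i *+ (n %% p) = v i *+ n.
  by rewrite {2}(divn_eq n p) mulrnDr mulnC mulrnA vp mul0rn add0r.
(* Reduced modulo [p], the coefficients land in the test family, and [pi_inj] lifts the relation to
   [G]. *)
have rel (c : 'I_k -> nat) : \sum_i v i *+ c i = 0 -> forall i, q *+ c i = 0.
  move=> c0 i; pose c' := [ffun i => Ordinal (ltn_pmod (c i) p_gt0)].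
  have qmod : q *+ c i = q *+ (c i %% p).
    by rewrite {1}(divn_eq (c i) p) mulrnDr mulnC mulrnA qp0 mul0rn add0r.
  have := hz c' _ i (ltn_ord i); rewrite valK => hz'.
  have -> : q *+ c i = pi_ab (gexp u (c' i)) by rewrite piX repr_abK qmod ffunE.
  rewrite hz' //; apply: pi_inj; rewrite pi1 -[RHS]c0 pi_gprod.
  apply: eq_bigr => j _.
  by rewrite valK (hom_gexp (hh j)) piX -modv ffunE.
have [B [m [cB pm BP]]] := local_generators (e := fun j => pi_ab (e j)) (q := v) p_pr (fun i => eQ (v i)).
have [i iB] : exists i, i \notin B.
  apply/existsP; rewrite -negb_forall; apply/negP => /forallP all.
  have : (#|'I_k| <= #|B|)%N by apply: subset_leq_card; apply/subsetP => t _.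
  by apply/negP; rewrite -ltnNge card_ord ltnS.
(* Combinations avoiding copy [i]; natural coefficients form a subgroup because [p.-1] acts as
   -1. *)
pose U (x : abel G) := exists2 c : 'I_k -> nat, c i = 0%N & x = \sum_j v j *+ c j.
have sU : is_zsub U.
  split; first by exists (fun=> 0%N) => //; rewrite big1.
  move=> _ _ [c ci ->] [d di ->]; exists (fun j => c j + d j * p.-1)%N; first by rewrite ci di.
  rewrite -sumrB; apply: eq_bigr => j _; rewrite mulrnDr; congr (_ + _).
  apply/eqP; rewrite eq_sym -addr_eq0 -mulrnDr -mulnSr prednK //.
  by rewrite mulnC mulrnA vp mul0rn.
have [b bB|c ci vi] := BP U sU _ i.
  exists (fun j => (j == b) : nat); first by case: eqP iB => // ->; rewrite bB.
  rewrite (bigD1 b) //= eqxx big1 ?addr0 // => j /negPf->; exact: mulr0n.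
(* Moving [v i *+ m] across its expression by the other copies gives a relation with coefficient
   [m * p.-1] at [i]. *)
have qm : q *+ m = 0.
  have := rel (fun j => if j == i then (m * p.-1)%N else c j) _ i; rewrite eqxx => E.
  have {}E : q *+ (m * p.-1) = 0.
    apply: E; rewrite (bigD1 i) //= eqxx.
    rewrite (eq_bigr (fun j => v j *+ c j)) => [|j /negPf-> //].
    move: vi; rewrite (bigD1 i) //= ci mulr0n add0r => <-.
    by rewrite -mulrnDr -mulnSr prednK // mulnC mulrnA vp mul0rn.
  apply/eqP; rewrite -oppr_eq0 -E eq_sym -addr_eq0 -mulrnDr -mulnSr prednK //.
  by rewrite mulnC mulrnA qp0 mul0rn.
have /eqP cop : coprime p m by rewrite prime_coprime.
have sZ : is_zsub (fun x : abel G => x = 0) by split=> // x y -> ->; rewrite subrr.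
by have := zsub_gcd sZ qp0 qm; rewrite cop mulr1n.
Qed.

(** * Free abelian groups of finite rank, and the equivalence *)

Lemma isomorphic_Zn_discriminating (G : group) (n : nat) :
  isomorphic G (Zn n) -> discriminating G.
Proof.
case=> f [hf [f' fK f'K]] hs.
have hf' : is_hom f' by move=> x y; apply: (can_inj fK); rewrite f'K hf !f'K.
have f1 : f gone = 0 := hom1 hf.
pose bnd (h : G * G) := (\sum_(i < n) `|(f h.1 : {ffun _}) i|)%N.
have [M Mb] : exists M : nat, forall h, List.In h hs -> (bnd h < M)%N.
  elim: hs => [|h s [M IHs]]; first by exists 0%N.
  by exists (maxn (bnd h).+1 M) => h' /= [<-|/IHs lt]; rewrite leq_max ?leqnn ?lt ?orbT.
(* [M] exceeds all coordinates involved, so [x + M y = 0] forces [x = y = 0]. *)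
exists (fun h => f' ((f h.1 : {ffun 'I_n -> int}) + (f h.2 : {ffun 'I_n -> int}) *+ M)); split.
  move=> x y; rewrite -hf'; congr f'; rewrite /= !hf /= mulrnDl.
  exact: addrACA.
move=> h /Mb lt; split=> [|->]; last first.
  by rewrite /= f1 mul0rn addr0; apply: (hom1 hf').
move=> E; have {}E : (f h.1 : {ffun 'I_n -> int}) + (f h.2 : {ffun 'I_n -> int}) *+ M = 0.
  by apply: (can_inj f'K); rewrite E; apply/esym/(hom1 hf').
have z2 : (f h.2 : {ffun 'I_n -> int}) = 0.
  apply/ffunP => i; rewrite [RHS]ffunE.
  have /(congr1 (fun x : {ffun 'I_n -> int} => x i)) := E.
  rewrite !ffunE ffunMnE.
  have : (`|(f h.1 : {ffun 'I_n -> int}) i| < M)%N.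
    by apply: leq_ltn_trans lt; rewrite /bnd (bigD1 i) //= leq_addr.
  move: (_ i) (_ i) => x y; nia.
have z1 : (f h.1 : {ffun 'I_n -> int}) = 0 by move: E; rewrite z2 mul0rn addr0.
have e1 : h.1 = gone by rewrite -[h.1]fK z1; apply: (hom1 hf').
have e2 : h.2 = gone by rewrite -[h.2]fK z2; apply: (hom1 hf').
by case: h e1 e2 {E lt z1 z2} => a b /= -> ->.
Qed.

(** Coordinates are picked by choice; freeness makes them unique, hence additive. *)
Lemma free_isomorphic_Zn (G : group) (n : nat) (e : 'I_n -> abel G) :
  injective (@pi_ab G) -> spans e -> (forall c, lincomb e c = 0 -> forall i, c i = 0) ->
  isomorphic G (Zn n).
Proof.
move=> pi_inj /choice[c cE] free.
have uniq d d' : lincomb e d = lincomb e d' -> d = d'.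
  move=> E; apply/funext => i; apply/eqP; rewrite -subr_eq0; apply/eqP.
  apply: (free (fun i => d i - d' i)).
  rewrite /lincomb; under eq_bigr do rewrite mulrzBr.
  by rewrite sumrB [X in X - _]E subrr.
have cD x y : lincomb e (fun i => c x i + c y i) = x + y.
  by rewrite [in RHS](cE x) [in RHS](cE y) -big_split; apply: eq_bigr => i _; rewrite mulrzDr.
exists (fun x => [ffun i => c (pi_ab x) i] : {ffun 'I_n -> int}); split.
  move=> x y; apply/ffunP => i; rewrite piM !ffunE.
  by have /(congr1 (fun d => d i)) := uniq _ _ (etrans (esym (cE _)) (esym (cD (pi_ab x) (pi_ab y)))).
exists (fun v : {ffun 'I_n -> int} => repr_ab (lincomb e v)) => [x|v] /=.
  apply: pi_inj; rewrite repr_abK [RHS]cE; congr lincomb.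
  by apply/funext => i; rewrite ffunE.
apply/ffunP => i; rewrite ffunE repr_abK.
by have /(congr1 (fun d => d i)) := uniq _ _ (esym (cE (lincomb e v))).
Qed.

Theorem theorem6p6 (G : group) :
  finitely_generated G -> solvable_group G ->
  (discriminating G <-> exists n : nat, isomorphic G (Zn n)).
Proof.
move=> fg sol; split=> [D|[n]]; last exact: isomorphic_Zn_discriminating.
have ab := discriminating_solvable_abelian D fg sol.
have [k [e [_ eQ]]] := ab_generated fg.
have sp : spans (fun i : 'I_k => pi_ab (e i)).
  by move=> q; have [c ->] := eQ q; exists (fun i => c i).
have [n [e' [spe' free]]] := torsion_free_basis (discriminating_torsion_free D fg ab) sp.
by exists n; apply: free_isomorphic_Zn (pi_ab_inj ab) spe' free.
Qed.
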